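(* Let $a\neq 0,1$ and $c$ be real numbers, let $k\ge 1$ be an integer, let $P_1$ be a real polynomial of degree $k+1$, and write $P_2(x)=P_1(x+a-1)-P_1(x)$ (so that $P_2$ is a polynomial of degree $k$). Assume that $P_2(n(a-1))\neq 0$ for $n\ge 0$, and define $$\gamma_{n+1}=P_2(n(a-1))\ (n\ge 0),\quad \lambda_n=P_1(n(a-1))\ (n\ge 0),\quad \beta_{n,1}=-\frac{\gamma_{n+1}}{\gamma_n},\quad \beta_{n,2}=-\frac1a\frac{\gamma_{n+1}}{\gamma_n}\ (n\ge 1),$$ and, for $i=1,2$, the polynomials $q_{0,i}=1$ and $q_{n,i}(x)=m_n^{a,c}(x)+\beta_{n,i}\,m_{n-1}^{a,c}(x)$ for $n\ge 1$, where $(m_n^{a,c})_n$ are the Meixner polynomials. Let $$D_1=P_1(D_{a,c})+\frac{a}{1-a}\Delta P_2(D_{a,c}),\qquad D_2=P_1(D_{a,c})+\frac{1}{1-a}\nabla P_2(D_{a,c}),$$ where $D_{a,c}$ is the second order Meixner difference operator. Then $D_1$ and $D_2$ are difference operators of order $2k+2$ and genre $(-k-1,k+1)$, and $D_i(q_{n,i})=\lambda_nq_{n,i}$ for all $n\ge 0$ and $i=1,2$.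
   Context: For $l\in\mathbb{Z}$ the shift operator $\mathfrak{s}_l$ acts on polynomials by $\mathfrak{s}_l(f)(x)=f(x+l)$; $\Delta f(x)=f(x+1)-f(x)$ and $\nabla f(x)=f(x)-f(x-1)$. A finite difference operator $\sum_{l=s}^r f_l\,\mathfrak{s}_l$ (with polynomial coefficients $f_l$) with $f_s,f_r\neq 0$ has order $r-s$ and genre $(s,r)$. For a linear operator $T$ and a polynomial $P(x)=\sum_j a_jx^j$, $P(T)=\sum_j a_jT^j$; products of operators are compositions. Meixner polynomials ($a\neq 0,1$): $m_n^{a,c}(x)=(-1)^n\sum_{j=0}^na^{-j}\binom{x}{j}\binom{-x-c}{n-j}$. Meixner operator: $D_{a,c}=x\,\mathfrak{s}_{-1}-[(1+a)x+ac]\,\mathfrak{s}_0+a(x+c)\,\mathfrak{s}_1$, which satisfies $D_{a,c}(m_n^{a,c})=n(a-1)m_n^{a,c}$. *)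

(* Defs.v *)
From HB Require Import structures.
From mathcomp Require Import all_boot all_order all_algebra.
From mathcomp Require Import reals.
Set Implicit Arguments.
Unset Strict Implicit.
Unset Printing Implicit Defensive.
Import Order.TTheory GRing.Theory Num.Theory.
Local Open Scope ring_scope.

(* Operators are plain maps {poly R} -> {poly R}; their product is composition. *)
Section Operators.
Variable R : realFieldType.
Implicit Types (P f : {poly R}) (T : {poly R} -> {poly R}).

Definition shiftop (l : int) f : {poly R} := f \Po ('X + (l%:~R)%:P).

Definition fdelta f : {poly R} := shiftop 1 f - f.

Definition bdelta f : {poly R} := f - shiftop (-1) f.

Definition poly_op P T : {poly R} -> {poly R} :=
  fun f => \sum_(j < size P) P`_j *: iter j T f.

(* T = \sum_(s <= l <= r) F l * shiftop l with F s, F r nonzero; l is s + i. *)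
Definition has_genre (s r : int) T : Prop :=
  s <= r /\
  exists F : int -> {poly R},
    [/\ F s != 0, F r != 0 &
        forall f, T f = \sum_(0 <= i < `|r - s|%N.+1)
                          F (s + i%:Z) * shiftop (s + i%:Z) f].

Definition has_order (d : nat) T : Prop :=
  exists s r : int, has_genre s r T /\ r - s = d%:Z.

End Operators.

Section Meixner.
Variable R : realFieldType.
Variables a c : R.

(* The generalized binomial coefficient binom(p, j), as a polynomial. *)
Definition binomp (p : {poly R}) (j : nat) : {poly R} :=
  (j`!%:R)^-1 *: \prod_(i < j) (p - (i%:R)%:P).

Definition meixner (n : nat) : {poly R} :=
  (-1) ^+ n *: \sum_(j < n.+1)
     a ^- j *: (binomp 'X j * binomp (- 'X - c%:P) (n - j)).

Definition meixner_op (f : {poly R}) : {poly R} :=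
  'X * shiftop (-1) f
  - ((1 + a) *: 'X + (a * c)%:P) * shiftop 0 f
  + (a *: ('X + c%:P)) * shiftop 1 f.

Definition meixner_comb (beta : nat -> R) (n : nat) : {poly R} :=
  if n is m.+1 then meixner n + beta n *: meixner m else 1.

End Meixner.

(* Main.v *)
Require Import Defs.
From HB Require Import structures.
From mathcomp Require Import all_boot all_order all_algebra.
From mathcomp Require Import reals.
From mathcomp Require Import ring zify.
Set Implicit Arguments.
Unset Strict Implicit.
Unset Printing Implicit Defensive.
Import Order.TTheory GRing.Theory Num.Theory.
Local Open Scope ring_scope.

(** Eigenvalues. Write m_n for the Meixner polynomials and D for the Meixner
operator. Because D m_n = n(a-1) m_n, a polynomial P(D) multiplies m_n by
P(n(a-1)); with lambda_n and gamma_(n+1) the values of P1 and P2 at n(a-1), the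
definition of P2 reads lambda_(n+1) - lambda_n = gamma_(n+1). The coefficient
beta_(n,i) = - tau gamma_(n+1)/gamma_n, with tau = 1 for i = 1 and tau = 1/a for
i = 2, is exactly the one for which P2(D) turns q_(n,i) into a multiple of
m_n - tau m_(n-1):
  P2(D) q_(n,i) = gamma_(n+1) (m_n - tau m_(n-1)),
  P1(D) q_(n,i) = lambda_n q_(n,i) + tau gamma_(n+1) m_(n-1).
The forward difference of m_n - m_(n-1) and the backward difference of
m_n - m_(n-1)/a both equal (1 - 1/a) m_(n-1), and the constants a/(1-a) and
1/(1-a) in D_1 and D_2 make the second summand cancel the excess
tau gamma_(n+1) m_(n-1). This is [poly_op_comb_eigen].

Meixner polynomials. Both facts about m_n used above come from the generating
function
  sum_n m_n(x) (-t)^n = (1 + t/a)^x (1 + t)^(-x-c),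
that is, m_n is up to sign the Cauchy product of two binomial sequences. A unit
shift of x multiplies one factor by 1 + t/a and divides the other by 1 + t, or
conversely, and multiplication by t is the operation [delay] on sequences.
[shiftop1_meixner_sub] is the equation of the generating function under
x -> x + 1, and [meixner_opE] follows by comparing the coefficients of the
Cauchy products, after the factors x and x + c of D have been absorbed in the
binomials.

Genre. The extreme coefficients of D^n are those produced by iterating the
extreme terms x s_(-1) and a(x+c) s_1 of D; they have degree n
([banded_iter], [size_low_coef], [size_high_coef]). Hence P1(D) has genre
(-k-1, k+1) with extreme coefficients of degree k+1. The difference of P2(D)
touches only one of the two extreme coefficients, and it adds to it a polynomial
of degree at most k, so neither one vanishes. *)

(** * Degree of a difference with step h *)

Section ForwardDifference.
Variable R : realFieldType.
Implicit Types p : {poly R}.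

Lemma size_comp_XaddC p (h : R) : size (p \Po ('X + h%:P)) = size p.
Proof. by rewrite size_comp_poly2 // size_XaddC. Qed.

(** By induction along p = q X + e, because the difference with step h satisfies
the product rule: it sends q X to (its value at q) X + h q(X + h). *)
Lemma comp_XaddC_sub_lead (h : R) m p : (size p <= m.+2)%N ->
  (size (p \Po ('X + h%:P) - p)%R <= m.+1)%N /\
  (p \Po ('X + h%:P) - p)`_m = m.+1%:R * h * p`_m.+1.
Proof.
elim: m p => [|m IHm] p hp; set q := drop_poly 1 p.
all: have hq : (size q <= (size p).-1)%N by rewrite size_drop_poly subn1.
all: have hpq : p = q * 'X + (p`_0)%:P.
1,3: by apply/polyP => -[|i]; rewrite coefD coefMX coefC ?add0r //= addr0 /q
       coef_drop_poly addn1.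
all: have hdp : p \Po ('X + h%:P) - p
       = (q \Po ('X + h%:P) - q) * 'X + h *: (q \Po ('X + h%:P)).
1,3: by rewrite [p in LHS]hpq comp_polyD comp_polyC comp_polyM comp_polyX
       -mul_polyC; ring.
all: have hpm j : p`_j.+1 = q`_j by rewrite /q coef_drop_poly addn1.
- have hq1 : (size q <= 1)%N by lia.
  rewrite hdp hpm (size1_polyC hq1) comp_polyC subrr mul0r add0r.
  rewrite coefZ coefC /= mul1r; split=> //.
  by rewrite (leq_trans (size_scale_leq _ _)) // size_polyC leq_b1.
- have hqm : (size q <= m.+2)%N by lia.
  have [hs hc] := IHm q hqm; rewrite hdp; split.
    rewrite (leq_trans (size_polyD _ _)) // geq_max.
    rewrite (leq_trans (size_polyMleq _ _)) ?size_polyX ?addn2 //=.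
    by rewrite (leq_trans (size_scale_leq _ _)) // size_comp_XaddC.
  rewrite coefD coefMX /= hc coefZ hpm.
  have -> : (q \Po ('X + h%:P))`_m.+1 = q`_m.+1.
    by apply/eqP; rewrite -subr_eq0 -coefB nth_default.
  by rewrite -!natr1; ring.
Qed.

Lemma size_comp_XaddC_sub (h : R) m p : h != 0 -> size p = m.+2 ->
  size (p \Po ('X + h%:P) - p) = m.+1.
Proof.
move=> h0 hp; have [|hs hc] := @comp_XaddC_sub_lead h m p; first by rewrite hp.
apply/anti_leq; rewrite hs ltnNge; apply/negP => /leq_sizeP/(_ m (leqnn _)).
apply/eqP; rewrite hc !mulf_neq0 ?pnatr_eq0 //.
by have := lead_coef_eq0 p; rewrite lead_coefE hp /= -size_poly_eq0 hp => ->.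
Qed.
End ForwardDifference.

(** * Cauchy products of sequences *)

Section Convolution.
Variable A : comNzRingType.
Implicit Types u v w : nat -> A.

Definition conv u v n : A := \sum_(j < n.+1) u j * v (n - j)%N.

(** Multiplication by the variable, when u is read as a formal power series. *)
Definition delay u n : A := if n is m.+1 then u m else 0.

Lemma eq_convl u u' v n : u =1 u' -> conv u v n = conv u' v n.
Proof. by move=> e; apply: eq_bigr => j _; rewrite e. Qed.

Lemma eq_convr u v v' n : v =1 v' -> conv u v n = conv u v' n.
Proof. by move=> e; apply: eq_bigr => j _; rewrite e. Qed.

Lemma convDl u u' v n :
  conv (fun j => u j + u' j) v n = conv u v n + conv u' v n.
Proof. by rewrite -big_split; apply: eq_bigr => j _; rewrite mulrDl. Qed.

Lemma convDr u v v' n :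
  conv u (fun j => v j + v' j) n = conv u v n + conv u v' n.
Proof. by rewrite -big_split; apply: eq_bigr => j _; rewrite mulrDr. Qed.

Lemma convMl a u v n : conv (fun j => a * u j) v n = a * conv u v n.
Proof. by rewrite mulr_sumr; apply: eq_bigr => j _; rewrite mulrA. Qed.

Lemma convMr a u v n : conv u (fun j => a * v j) n = a * conv u v n.
Proof. by rewrite mulr_sumr; apply: eq_bigr => j _; rewrite mulrCA. Qed.

Lemma conv_delayl u v n : conv (delay u) v n = delay (conv u v) n.
Proof.
case: n => [|n]; first by rewrite /conv big_ord1 mul0r.
by rewrite /conv big_ord_recl mul0r add0r.
Qed.

Lemma conv_delayr u v n : conv u (delay v) n = delay (conv u v) n.
Proof.
case: n => [|n]; first by rewrite /conv big_ord1 mulr0.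
rewrite /conv big_ord_recr /= subnn mulr0 addr0.
by apply: eq_bigr => j _; rewrite subSn // -ltnS.
Qed.
End Convolution.

(** * Binomial coefficients of a polynomial *)

Section Binomial.
Variable R : realFieldType.
Implicit Types p : {poly R}.

Lemma binomp0 p : binomp p 0 = 1.
Proof. by rewrite /binomp big_ord0 fact0 invr1 scale1r. Qed.

Lemma binompS p j : (j.+1%:R)%:P * binomp p j.+1 = (p - (j%:R)%:P) * binomp p j.
Proof.
rewrite /binomp big_ord_recr /= factS natrM invfM -!mul_polyC.
rewrite mulrA -polyCM mulVKf ?pnatr_eq0 //.
by rewrite [RHS]mulrCA [in RHS](mulrC (p - _)).
Qed.

(** Absorption: this is how the polynomial coefficients of the Meixner operator
become scalar weights on the terms of a Cauchy product. *)
Lemma binompM p j : p * binomp (p - 1) j = (p - (j%:R)%:P) * binomp p j.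
Proof.
rewrite /binomp -!scalerAr; congr (_ *: _).
transitivity (\prod_(i < j.+1) (p - (i%:R)%:P)); last first.
  by rewrite big_ord_recr mulrC.
rewrite big_ord_recl /= subr0; congr (_ * _).
apply: eq_bigr => i _; rewrite /bump /= add1n -natr1 polyCD; ring.
Qed.

(** Pascal's rule; on generating functions, (1+t)^p = (1+t) (1+t)^(p-1). *)
Lemma binompB1 p j : binomp p j = binomp (p - 1) j + delay (binomp (p - 1)) j.
Proof.
case: j => [|j] /=; first by rewrite !binomp0 addr0.
have h0 : (j.+1%:R)%:P != 0 :> {poly R} by rewrite polyC_eq0 pnatr_eq0.
apply: (mulfI h0); rewrite mulrDr !binompS -binompM -mulrDl.
by congr (_ * _); rewrite -natr1 polyCD; ring.
Qed.

Lemma binompD1 p j : binomp (p + 1) j = binomp p j + delay (binomp p) j.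
Proof. by rewrite binompB1 addrK. Qed.

Lemma shiftop_binomp l p j : shiftop l (binomp p j) = binomp (shiftop l p) j.
Proof.
rewrite /shiftop /binomp comp_polyZ rmorph_prod; congr (_ *: _).
by apply: eq_bigr => i _ /=; rewrite comp_polyB comp_polyC.
Qed.
End Binomial.

(** * Meixner polynomials *)

Section Meixner.
Variables (R : realFieldType) (a c : R).

(* U and W have the generating functions (1 + t/a)^x and (1 + t)^(-x-c), and W1
   is W after the shift x -> x + 1. *)
Let U j : {poly R} := (a ^- j)%:P * binomp 'X j.
Let W j : {poly R} := binomp (- 'X - c%:P) j.
Let W1 j : {poly R} := binomp (- 'X - c%:P - 1) j.

Lemma meixnerE n : meixner a c n = (-1) ^+ n *: conv U W n.
Proof.
by congr (_ *: _); apply: eq_bigr => j _; rewrite /U -mulrA mul_polyC.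
Qed.

Lemma meixner0 : meixner a c 0 = 1.
Proof.
by rewrite meixnerE /conv big_ord1 /U /W !binomp0 !mulr1 scale1r invr1.
Qed.

Lemma shiftop_conv l u v n : shiftop l (conv u v n)
  = conv (fun j => shiftop l (u j)) (fun j => shiftop l (v j)) n :> {poly R}.
Proof.
rewrite /shiftop rmorph_sum; apply: eq_bigr => j _ /=.
by rewrite comp_polyM.
Qed.

Lemma shiftop1_U j : shiftop 1 (U j) = U j + (a^-1)%:P * delay U j.
Proof.
rewrite /U /shiftop comp_polyM comp_polyC -/(shiftop 1 _) shiftop_binomp.
rewrite /shiftop comp_polyX polyC1 binompD1 mulrDr; congr (_ + _).
case: j => [|j] /=; first by rewrite !mulr0.
by rewrite mulrA -polyCM exprS invfM.
Qed.

Lemma shiftop1_W j : shiftop 1 (W j) = W1 j.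
Proof.
rewrite /W /W1 shiftop_binomp; congr (binomp _ j).
by rewrite /shiftop comp_polyB comp_polyC rmorphN /= comp_polyX polyC1; ring.
Qed.

Lemma shiftopN1_U j : 'X * shiftop (-1) (U j) = ('X - (j%:R)%:P) * U j.
Proof.
rewrite /U /shiftop comp_polyM comp_polyC -/(shiftop (-1) _) shiftop_binomp.
have -> : shiftop (-1) 'X = 'X - 1 :> {poly R}.
  by rewrite /shiftop comp_polyX polyCN polyC1.
by rewrite mulrCA binompM mulrCA.
Qed.

Lemma shiftopN1_W j : shiftop (-1) (W j) = W j + delay W j.
Proof.
rewrite -binompD1 /W shiftop_binomp; congr (binomp _ j).
rewrite /shiftop comp_polyB comp_polyC rmorphN /= comp_polyX polyCN polyC1.
ring.
Qed.

Lemma W_W1 j : W j = W1 j + delay W1 j.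
Proof. exact: binompB1. Qed.

(** With M(x) the generating function (1 - t/a)^x (1 - t)^(-x-c) of the m_n(x),
this is the coefficient of t^(n+1) in (1 - t) M(x+1) = (1 - t/a) M(x). Both the
forward and the backward difference relations follow from it. *)
Lemma shiftop1_meixner_sub n :
  shiftop 1 (meixner a c n.+1 - meixner a c n)
    = meixner a c n.+1 - a^-1 *: meixner a c n.
Proof.
rewrite !meixnerE /shiftop comp_polyB !comp_polyZ -!/(shiftop 1 _).
rewrite !shiftop_conv !(eq_convl _ _ shiftop1_U) !(eq_convr _ _ shiftop1_W).
set V := fun j => U j + _.
have -> : conv V W1 n.+1 = conv V W n.+1 - conv V W1 n.
  by rewrite (eq_convr _ _ W_W1) convDr conv_delayr addrK.
rewrite convDl convMl conv_delayl /= -!mul_polyC !exprS !polyCM polyCN polyC1.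
ring.
Qed.

(** Each of the three terms of the operator is written as a Cauchy product of U
and W with weights: [delay] is moved from one factor to the other, where it is
undone by the recursion j C(p,j) = (p-j+1) C(p,j-1). In the sum, the weight of
the term of index (j, i), i + j = n, is then the constant (a-1)(j+i). *)
Lemma meixner_opE n : a != 0 ->
  meixner_op a c (meixner a c n) = (n%:R * (a - 1)) *: meixner a c n.
Proof.
move=> a0; rewrite /meixner_op !meixnerE /shiftop !comp_polyZ -!/(shiftop _ _).
have -> : shiftop 0 (conv U W n) = conv U W n.
  by rewrite /shiftop addr0 comp_polyXr.
(* Pascal's rule produces a delay of W; transferred to U, it turns (x-j) U_j
   into a j U_j. *)
have back : 'X * shiftop (-1) (conv U W n)
    = conv (fun j => ('X - (j%:R)%:P + (a * j%:R)%:P) * U j) W n.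
  rewrite shiftop_conv -convMl (eq_convl _ _ shiftopN1_U).
  rewrite (eq_convr _ _ shiftopN1_W) convDr conv_delayr -conv_delayl -convDl.
  apply: eq_convl => -[|j] /=; first by rewrite mulr0 !addr0.
  rewrite [RHS]mulrDl; congr (_ + _).
  rewrite /U polyCM -mulrA [in RHS](mulrCA (j.+1%:R)%:P) binompS.
  rewrite !mulrA -polyCM exprS invfM mulVKf //; ring.
(* Here the delay of U goes to W, and turns (x+c+j) W_j into - j W_j. *)
have forw : a *: ('X + c%:P) * shiftop 1 (conv U W n)
    = conv U (fun j => (a *: ('X + c%:P + (j%:R)%:P) - (j%:R)%:P) * W j) n.
  have e j : ('X + c%:P) * W1 j = ('X + c%:P + (j%:R)%:P) * W j.
    apply: oppr_inj; transitivity ((- 'X - c%:P) * W1 j); first by ring.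
    by rewrite /W1 binompM -/(W j); ring.
  rewrite shiftop_conv (eq_convl _ _ shiftop1_U) (eq_convr _ _ shiftop1_W).
  rewrite -mul_polyC -mulrA -!convMr (eq_convr _ _ (fun j => congr1 _ (e j))).
  rewrite convDl convMl conv_delayl -conv_delayr convMr -[_ * conv _ (delay _) _]convMr.
  rewrite -convMr -convDr; apply: eq_convr => -[|j] /=.
    by rewrite mulr0 addr0 -mul_polyC; ring.
  rewrite mulrA -polyCM mulVf // mul1r -mul_polyC [RHS]mulrBl binompS.
  by rewrite mulrA; congr (_ + _); ring.
rewrite -scalerAr back -!scalerAr forw -scalerBr -scalerDr.
rewrite [RHS]scalerA [_%:R * _ * _]mulrC -[RHS]scalerA.
congr (_ *: _); rewrite /conv -[RHS]mul_polyC !mulr_sumr -sumrB -big_split.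
apply: eq_bigr => j _ /=.
have -> : n%:R = (n - j)%:R + j%:R :> R by rewrite -natrD subnK // -ltnS.
rewrite -!mul_polyC !(polyCM, polyCD, polyCN, polyC1).
ring.
Qed.
End Meixner.

(** * Polynomials in an operator and its eigenvectors *)

Section Spectral.
Variable R : realFieldType.
Implicit Types (P u v : {poly R}) (T E : {poly R} -> {poly R}).

Lemma iter_linear T j : linear T -> linear (iter j T).
Proof. by move=> lT; elim: j => [//|j IHj] k u v; rewrite !iterS IHj lT. Qed.

Lemma linear_scalable T : linear T -> scalable T.
Proof.
move=> lT.
have T0 : T 0 = 0.
  by have := lT (-1) 0 0; rewrite scaler0 addr0 scaleN1r addNr.
by move=> k w; have := lT k w 0; rewrite T0 !addr0.
Qed.

Lemma poly_op_linear P T : linear T -> linear (poly_op P T).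
Proof.
move=> lT k u v; rewrite /poly_op scaler_sumr -big_split.
apply: eq_bigr => j _ /=.
by rewrite iter_linear // scalerDr scalerA mulrC -scalerA.
Qed.

Lemma poly_op_eigen P T (mu : R) v :
  scalable T -> T v = mu *: v -> poly_op P T v = P.[mu] *: v.
Proof.
move=> sT ev; rewrite horner_coef scaler_suml; apply: eq_bigr => j _.
rewrite -scalerA; congr (_ *: _); elim: (j : nat) => [|i IHi].
  by rewrite scale1r.
by rewrite iterS IHi sT ev scalerA -exprSr.
Qed.

(** The coefficient of v in q makes P2(T) q a multiple of u - tau v, whose image
under kappa E is a multiple of v; it compensates the error made by replacing the
eigenvalue P1(mu) of P1(T) on v by P1(mu') = P1(mu) + P2(mu). *)
Lemma poly_op_comb_eigen T E P1 P2 u v (mu mu' tau kappa delta : R) :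
  linear T -> scalable E -> T u = mu' *: u -> T v = mu *: v ->
  P1.[mu'] - P1.[mu] = P2.[mu] -> P2.[mu] != 0 ->
  E (u - tau *: v) = delta *: v -> kappa * delta = - tau ->
  let q := u + (- (tau * (P2.[mu'] / P2.[mu]))) *: v in
  poly_op P1 T q + kappa *: E (poly_op P2 T q) = P1.[mu'] *: q.
Proof.
move=> lT sE eu ev hP h0 hE hk q.
have sT := linear_scalable lT.
have -> : q = (- (tau * (P2.[mu'] / P2.[mu]))) *: v + u by rewrite addrC.
rewrite !poly_op_linear // !(poly_op_eigen _ sT eu) !(poly_op_eigen _ sT ev).
set g := P2.[mu'].
have -> : - (tau * (g / P2.[mu])) *: (P2.[mu] *: v) + g *: u
          = g *: (u - tau *: v).
  rewrite scalerBr addrC !scalerA -scaleNr; congr (_ + _ *: _).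
  by field.
rewrite sE hE !scalerA.
have -> : kappa * g * delta = - (g * tau) by rewrite mulrAC hk mulNr mulrC.
rewrite -[P1.[mu']](subrK P1.[mu]) hP scalerDr addrAC -scalerDl scalerA.
congr (_ *: _ + _); by field.
Qed.
End Spectral.

(** * Genre of difference operators *)

Section Genre.
Variable R : realFieldType.
Implicit Types (b t f p : {poly R}) (T : {poly R} -> {poly R}).

(** A difference operator supported on the shifts from -N to N. The extreme
coefficients b and t may vanish, so that the notion is stable under sums and
under widening of the window; the coefficient of index i belongs to the shift
by i - N. *)
Definition banded N b t T := exists F : nat -> {poly R},
  [/\ F 0 = b, F N.*2 = t
    & forall f, T f = \sum_(i < N.*2.+1) F i * shiftop (i%:Z - N%:Z) f].

Lemma shiftop_shiftop l m f : shiftop l (shiftop m f) = shiftop (l + m) f.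
Proof.
rewrite /shiftop -comp_polyA; congr (_ \Po _).
by rewrite comp_polyD comp_polyX comp_polyC -addrA -polyCD intrD.
Qed.

Lemma shiftop0 f : shiftop 0 f = f.
Proof. by rewrite /shiftop addr0 comp_polyXr. Qed.

Lemma banded_id : banded 0 1 1 (fun f : {poly R} => f).
Proof. by exists (fun=> 1); split=> // f; rewrite big_ord1 subrr shiftop0 mul1r. Qed.

Lemma bandedD N b t b' t' T T' : banded N b t T -> banded N b' t' T' ->
  banded N (b + b') (t + t') (fun f => T f + T' f).
Proof.
move=> [F [<- <- hF]] [F' [<- <- hF']]; exists (fun i => F i + F' i).
split=> // f; rewrite hF hF' -big_split; apply: eq_bigr => i _ /=.
by rewrite mulrDl.
Qed.

Lemma bandedZ (k : R) N b t T : banded N b t T ->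
  banded N (k *: b) (k *: t) (fun f => k *: T f).
Proof.
move=> [F [<- <- hF]]; exists (fun i => k *: F i).
split=> // f; rewrite hF scaler_sumr; apply: eq_bigr => i _.
by rewrite scalerAl.
Qed.

(** Composing with a three-term operator widens the window by one on each side;
an extreme coefficient of the composite has only one contribution. *)
Lemma banded_comp3 (al be de : {poly R}) N b t T : banded N b t T ->
  banded N.+1 (al * shiftop (-1) b) (de * shiftop 1 t)
    (fun f => al * shiftop (-1) (T f) + be * T f + de * shiftop 1 (T f)).
Proof.
move=> [F [<- <- hF]].
(* F is arbitrary beyond N.*2, while the coefficients of the composite must
   not see these values. *)
pose cut (i : nat) p := if (i <= N.*2)%N then p else 0.
pose G i := al * shiftop (-1) (cut i (F i))
  + be * delay (fun j => cut j (F j)) i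
  + de * shiftop 1 (delay (delay F) i).
have s0 l : shiftop l 0 = 0 :> {poly R} by rewrite /shiftop comp_poly0.
exists G; split.
- by rewrite /G /cut /= s0 !mulr0 !addr0.
- by rewrite /G doubleS /cut /= ltnn ltnNge leqnSn /= s0 !mulr0 !add0r.
move=> f; rewrite hF.
have shs l : shiftop l (\sum_(i < N.*2.+1) F i * shiftop (i%:Z - N%:Z) f)
   = \sum_(i < N.*2.+1) shiftop l (F i) * shiftop (l + (i%:Z - N%:Z)) f.
  rewrite /shiftop rmorph_sum; apply: eq_bigr => i _ /=.
  by rewrite comp_polyM -!/(shiftop _ _) shiftop_shiftop.
have hG i p : G i * p = al * (shiftop (-1) (cut i (F i)) * p)
  + be * (delay (fun j => cut j (F j)) i * p)
  + de * (shiftop 1 (delay (delay F) i) * p) by rewrite /G; ring.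
rewrite !shs; under [RHS]eq_bigr do rewrite hG.
rewrite !big_split /= -!mulr_sumr.
congr (_ * _ + _ * _ + _ * _).
- rewrite doubleS 2![in RHS]big_ord_recr /= /cut ltnn ltnNge leqnSn /= s0 !mul0r !addr0.
  apply: eq_bigr => i _; rewrite -ltnS ltn_ord; congr (_ * shiftop _ _).
  lia.
- rewrite doubleS [RHS]big_ord_recl [in RHS]big_ord_recr /= /cut ltnn !mul0r.
  rewrite add0r addr0.
  apply: eq_bigr => i _; rewrite -ltnS ltn_ord; congr (_ * shiftop _ _).
  by rewrite /bump /=; lia.
- rewrite doubleS 2![in RHS]big_ord_recl /= s0 !mul0r !add0r.
  apply: eq_bigr => i _; congr (_ * shiftop _ _).
  by rewrite /bump /=; lia.
Qed.

Lemma eq_banded N b t T T' : T =1 T' -> banded N b t T -> banded N b t T'.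
Proof. by move=> e [F [hb ht hF]]; exists F; split=> // f; rewrite -e. Qed.

Lemma banded_widen N b t T : banded N b t T -> banded N.+1 0 0 T.
Proof.
move=> /(banded_comp3 0 1 0); rewrite !mul0r; apply: eq_banded => f.
by rewrite !mul0r mul1r add0r addr0.
Qed.

Lemma banded_genre N b t T : b != 0 -> t != 0 -> banded N b t T ->
  has_genre (- N%:Z) N%:Z T.
Proof.
move=> b0 t0 [F [hb ht hF]]; split; first by lia.
exists (fun z : int => F (absz (z + N%:Z))); split.
- by rewrite addNr hb.
- by rewrite (_ : absz (N%:Z + N%:Z) = N.*2) ?ht //; lia.
move=> f; rewrite hF (_ : absz (N%:Z - - N%:Z) = N.*2); last by lia.
rewrite big_mkord; apply: eq_bigr => i _; congr (F _ * shiftop _ _); lia.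
Qed.

Section Powers.
Variables a c : R.

(** The coefficients of the shifts by -n and n in the n-th power of the Meixner
operator: x(x-1)...(x-n+1) and a^n (x+c)...(x+c+n-1). *)
Definition low_coef n : {poly R} :=
  iter n (fun p => 'X * shiftop (-1) p) 1.
Definition high_coef n : {poly R} :=
  iter n (fun p => a *: ('X + c%:P) * shiftop 1 p) 1.

Lemma size_low_coef n : size (low_coef n) = n.+1.
Proof.
elim: n => [|n IHn]; first by rewrite size_poly1.
rewrite /low_coef iterS -/(low_coef n) mulrC size_mulX ?size_comp_XaddC ?IHn //.
by rewrite -size_poly_eq0 size_comp_XaddC IHn.
Qed.

Lemma size_high_coef n : a != 0 -> size (high_coef n) = n.+1.
Proof.
move=> a0; elim: n => [|n IHn]; first by rewrite size_poly1.
rewrite /high_coef iterS -/(high_coef n) -scalerAl size_scale //.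
have h0 : shiftop 1 (high_coef n) != 0.
  by rewrite -size_poly_eq0 size_comp_XaddC IHn.
by rewrite size_mul ?size_XaddC ?size_comp_XaddC ?IHn // -size_poly_eq0 size_XaddC.
Qed.

Lemma banded_iter n :
  banded n (low_coef n) (high_coef n) (iter n (meixner_op a c)).
Proof.
elim: n => [|n IHn]; first exact: banded_id.
have := banded_comp3 'X (- ((1 + a) *: 'X + (a * c)%:P)) (a *: ('X + c%:P)) IHn.
apply: eq_banded => f.
by rewrite iterS [RHS]/meixner_op shiftop0 mulNr.
Qed.

Lemma banded_poly_op (P : {poly R}) n : size P = n.+1 ->
  banded n (P`_n *: low_coef n) (P`_n *: high_coef n)
    (poly_op P (meixner_op a c)).
Proof.
rewrite /poly_op => ->; elim: n => [|n IHn].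
  apply: eq_banded (bandedZ _ (banded_iter 0)) => f.
  by rewrite big_ord1.
have := bandedD (banded_widen IHn) (bandedZ P`_n.+1 (banded_iter n.+1)).
rewrite !add0r; apply: eq_banded => f.
by rewrite [RHS]big_ord_recr.
Qed.

Lemma addr_neq0_size (p q : {poly R}) : (size q < size p)%N -> p + q != 0.
Proof.
by move=> h; rewrite -size_poly_gt0 size_polyDl //; apply: leq_ltn_trans h.
Qed.

(** The forward difference leaves the lowest coefficient unchanged, and adds to
the highest one a polynomial of smaller degree. *)
Lemma genre_delta (P Q : {poly R}) n (kappa : R) : a != 0 ->
  size P = n.+2 -> size Q = n.+1 ->
  has_genre (- n.+1%:Z) n.+1%:Z
    (fun f => poly_op P (meixner_op a c) f
              + kappa *: fdelta (poly_op Q (meixner_op a c) f)).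
Proof.
move=> a0 hP hQ.
have P0 : P`_n.+1 != 0.
  by have := lead_coef_eq0 P; rewrite lead_coefE hP -size_poly_eq0 hP => ->.
have hB := bandedD (banded_poly_op hP)
  (bandedZ kappa (banded_comp3 0 (-1) 1 (banded_poly_op hQ))).
apply: banded_genre (eq_banded _ hB) => [||f].
- rewrite mul0r scaler0 addr0 scaler_eq0 negb_or P0.
  by rewrite -size_poly_eq0 size_low_coef.
- apply: addr_neq0_size; rewrite mul1r [ltnRHS]size_scale // size_high_coef //.
  rewrite (leq_ltn_trans (size_scale_leq _ _)) // size_comp_XaddC.
  by rewrite (leq_ltn_trans (size_scale_leq _ _)) // size_high_coef.
- by rewrite /fdelta mul0r add0r mulN1r mul1r [- _ + _]addrC.
Qed.

(** The roles of the two ends are exchanged: the backward difference only reaches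
the lowest coefficient. *)
Lemma genre_nabla (P Q : {poly R}) n (kappa : R) : a != 0 ->
  size P = n.+2 -> size Q = n.+1 ->
  has_genre (- n.+1%:Z) n.+1%:Z
    (fun f => poly_op P (meixner_op a c) f
              + kappa *: bdelta (poly_op Q (meixner_op a c) f)).
Proof.
move=> a0 hP hQ.
have P0 : P`_n.+1 != 0.
  by have := lead_coef_eq0 P; rewrite lead_coefE hP -size_poly_eq0 hP => ->.
have hB := bandedD (banded_poly_op hP)
  (bandedZ kappa (banded_comp3 (-1) 1 0 (banded_poly_op hQ))).
apply: banded_genre (eq_banded _ hB) => [||f].
- apply: addr_neq0_size; rewrite mulN1r scalerN size_polyN.
  rewrite [ltnRHS]size_scale // size_low_coef //.
  rewrite (leq_ltn_trans (size_scale_leq _ _)) // size_comp_XaddC.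
  by rewrite (leq_ltn_trans (size_scale_leq _ _)) // size_low_coef.
- rewrite mul0r scaler0 addr0 scaler_eq0 negb_or P0.
  by rewrite -size_poly_eq0 size_high_coef.
- by rewrite /bdelta mul0r addr0 mulN1r mul1r [- _ + _]addrC.
Qed.
End Powers.
End Genre.

(** * The two families of eigenfunctions *)

Section Linearity.
Variable R : realFieldType.

Lemma shiftop_linear l : linear (@shiftop R l).
Proof. by move=> k f g; rewrite /shiftop comp_polyD comp_polyZ. Qed.

Lemma fdelta_scalable : scalable (@fdelta R).
Proof. by move=> k f; rewrite /fdelta /shiftop comp_polyZ scalerBr. Qed.

Lemma bdelta_scalable : scalable (@bdelta R).
Proof. by move=> k f; rewrite /bdelta /shiftop comp_polyZ scalerBr. Qed.

Lemma meixner_op_linear (a c : R) : linear (meixner_op a c).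
Proof.
by move=> k f g; rewrite /meixner_op !shiftop_linear -!mul_polyC; ring.
Qed.

Variables a c : R.

Lemma fdelta_meixner n :
  fdelta (meixner a c n.+1 - 1 *: meixner a c n)
    = (1 - a^-1) *: meixner a c n.
Proof.
by rewrite scale1r /fdelta shiftop1_meixner_sub -!mul_polyC polyCB polyC1; ring.
Qed.

Lemma bdelta_meixner n :
  bdelta (meixner a c n.+1 - a^-1 *: meixner a c n)
    = (1 - a^-1) *: meixner a c n.
Proof.
rewrite /bdelta -shiftop1_meixner_sub shiftop_shiftop addNr shiftop0.
by rewrite shiftop1_meixner_sub -!mul_polyC polyCB polyC1; ring.
Qed.
End Linearity.

Theorem theorem5p2 (R : realType) (a c : R) (k : nat) (P1 P2 : {poly R})
    (gamma lambda beta1 beta2 : nat -> R) (q1 q2 : nat -> {poly R})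
    (D1 D2 : {poly R} -> {poly R})
    (ha0 : a != 0) (ha1 : a != 1) (hk : (1 <= k)%N)
    (hP1 : size P1 = k.+2)
    (hP2 : P2 = P1 \Po ('X + (a - 1)%:P) - P1)
    (hP2n0 : forall n : nat, P2.[n%:R * (a - 1)] != 0)
    (hgamma : forall n : nat, gamma n.+1 = P2.[n%:R * (a - 1)])
    (hlambda : forall n : nat, lambda n = P1.[n%:R * (a - 1)])
    (hbeta1 : forall n : nat, (1 <= n)%N ->
       beta1 n = - (gamma n.+1 / gamma n))
    (hbeta2 : forall n : nat, (1 <= n)%N ->
       beta2 n = - (1 / a * (gamma n.+1 / gamma n)))
    (hq1 : forall n : nat, q1 n = meixner_comb a c beta1 n)
    (hq2 : forall n : nat, q2 n = meixner_comb a c beta2 n)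
    (hD1 : forall f : {poly R},
       D1 f = poly_op P1 (meixner_op a c) f
              + (a / (1 - a)) *: fdelta (poly_op P2 (meixner_op a c) f))
    (hD2 : forall f : {poly R},
       D2 f = poly_op P1 (meixner_op a c) f
              + (1 / (1 - a)) *: bdelta (poly_op P2 (meixner_op a c) f)) :
  size P2 = k.+1 /\
  [/\ has_order (2 * k + 2) D1 /\ has_genre (- (k.+1)%:Z) (k.+1)%:Z D1,
      has_order (2 * k + 2) D2 /\ has_genre (- (k.+1)%:Z) (k.+1)%:Z D2,
      (forall n : nat, D1 (q1 n) = lambda n *: q1 n)
    & (forall n : nat, D2 (q2 n) = lambda n *: q2 n)].

Proof.
have a10 : a - 1 != 0 by rewrite subr_eq0.
have a10' : 1 - a != 0 by rewrite subr_eq0 eq_sym.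
have sP2 : size P2 = k.+1 by rewrite hP2; apply: size_comp_XaddC_sub.
have gD1 : has_genre (- (k.+1)%:Z) (k.+1)%:Z D1.
  have [sr [F [F0 F1 hF]]] := genre_delta c (a / (1 - a)) ha0 hP1 sP2.
  by split=> //; exists F; split=> // f; rewrite hD1 -hF.
have gD2 : has_genre (- (k.+1)%:Z) (k.+1)%:Z D2.
  have [sr [F [F0 F1 hF]]] := genre_nabla c (1 / (1 - a)) ha0 hP1 sP2.
  by split=> //; exists F; split=> // f; rewrite hD2 -hF.
have ord T : has_genre (- (k.+1)%:Z) (k.+1)%:Z T -> has_order (2 * k + 2) T.
  by move=> g; exists (- (k.+1)%:Z), (k.+1)%:Z; split=> //; lia.
have step (n : nat) :
  P1.[n.+1%:R * (a - 1)] - P1.[n%:R * (a - 1)] = P2.[n%:R * (a - 1)].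
  rewrite hP2 hornerD hornerN horner_comp hornerD hornerX hornerC.
  by congr (P1.[_] - _); rewrite -natr1; ring.
have lT := meixner_op_linear a c.
have eig n := meixner_opE c n ha0.
have sT := linear_scalable lT.
have op1 (P : {poly R}) : poly_op P (meixner_op a c) 1 = (P.[0])%:P.
  have := eig 0; rewrite meixner0 mul0r => /(poly_op_eigen P sT) ->.
  by rewrite -mul_polyC mulr1.
split=> //; split; try by split; auto.
- case=> [|n].
    rewrite hq1 hD1 hlambda mul0r /= !op1 /fdelta /shiftop comp_polyC subrr.
    by rewrite scaler0 addr0 -mul_polyC mulr1.
  rewrite hq1 hD1 hlambda /= hbeta1 // !hgamma.
  have := poly_op_comb_eigen lT (@fdelta_scalable R) (eig n.+1) (eig n)
    (step n) (hP2n0 n) (fdelta_meixner a c n) (kappa := a / (1 - a)).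
  by rewrite mul1r; apply; field; rewrite ha0 a10'.
- case=> [|n].
    rewrite hq2 hD2 hlambda mul0r /= !op1 /bdelta /shiftop comp_polyC subrr.
    by rewrite scaler0 addr0 -mul_polyC mulr1.
  rewrite hq2 hD2 hlambda /= hbeta2 // !hgamma div1r.
  have := poly_op_comb_eigen lT (@bdelta_scalable R) (eig n.+1) (eig n)
    (step n) (hP2n0 n) (bdelta_meixner a c n) (kappa := 1 / (1 - a)).
  by apply; field; rewrite ha0 a10'.
Qed.
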